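(* A complete list of inequivalent, one-dimensional subalgebras of $\mathfrak{sp}(4,\mathbb{C})$ with nilpotent generators, up to conjugacy in $Sp(4,\mathbb{C})$, is $$\langle X_{\beta}\rangle;\qquad \langle X_{\alpha}\rangle;\qquad \langle X_{\alpha}+X_{\beta}\rangle .$$
   Context: Let $J=\begin{pmatrix}0&0&1&0\\0&0&0&1\\-1&0&0&0\\0&-1&0&0\end{pmatrix}$. $\mathfrak{sp}(4,\mathbb{C})$ is the Lie algebra of $4\times4$ complex matrices $X$ with $JX^tJ=X$, and $Sp(4,\mathbb{C})=\{g\in GL(4,\mathbb{C}) : gJg^t=J\}$, acting on $\mathfrak{sp}(4,\mathbb{C})$ by conjugation $X\mapsto gXg^{-1}$. Elements are nilpotent if they are so as matrices. With $E_{ij}$ the matrix units, $X_\alpha=E_{24}$ and $X_\beta=E_{12}-E_{43}$. $\langle\,\cdot\,\rangle$ denotes the complex linear span. Two subalgebras are equivalent (conjugate) if some $g\in Sp(4,\mathbb{C})$ conjugates one onto the other. A generator of a one-dimensional subalgebra is a nonzero element of it. *)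

(* Defs.v *)
From mathcomp Require Import all_boot all_order all_algebra.
From mathcomp Require Export reals complex.

Set Implicit Arguments.
Unset Strict Implicit.
Unset Printing Implicit Defensive.

Local Open Scope ring_scope.

Section Sp4.
Variable F : fieldType.
Implicit Types (X Y g : 'M[F]_4) (U V : {vspace 'M[F]_4}).

(* Matrix units with indices counted from 1, for 1 <= i, j <= 4. *)
Definition E (i j : nat) : 'M[F]_4 := delta_mx (inord i.-1) (inord j.-1).

Definition J : 'M[F]_4 := E 1 3 + E 2 4 - E 3 1 - E 4 2.

Definition sp4 : {pred 'M[F]_4} := [pred X | J *m X^T *m J == X].

Definition Sp4 : {pred 'M[F]_4} :=
  [pred g | (g \in unitmx) && (g *m J *m g^T == J)].

Definition bracket X Y : 'M[F]_4 := X *m Y - Y *m X.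

Definition Lie_subalgebra U : Prop :=
  {subset U <= sp4} /\ {in U &, forall X Y, bracket X Y \in U}.

Definition nilpotent_mx X : Prop := exists k : nat, X ^+ k = 0.

Definition one_dim_nilpotent_subalgebra U : Prop :=
  [/\ Lie_subalgebra U, \dim U = 1%N &
      exists X, [/\ X \in U, X != 0 & nilpotent_mx X]].

Definition Sp4_conjugate U V : Prop :=
  exists2 g, g \in Sp4 &
    forall Y, Y \in V <-> exists2 X, X \in U & Y = g *m X *m invmx g.

Definition X_alpha : 'M[F]_4 := E 2 4.
Definition X_beta : 'M[F]_4 := E 1 2 - E 4 3.

Definition complete_list (T : eqType) (P : T -> Prop) (equiv : T -> T -> Prop)
    (s : seq T) : Prop :=
  [/\ {in s, forall x, P x},
      forall x0 i j, (i < size s)%N -> (j < size s)%N -> i <> j ->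
        ~ equiv (nth x0 s i) (nth x0 s j) &
      forall x, P x -> exists2 y, y \in s & equiv x y].

End Sp4.

(* Main.v *)
(* Read g in Sp4 through its rows: they form a symplectic basis for the form
   omega u v = u J v^T on row vectors, and g X g^-1 = N says that X acts on this
   basis as N prescribes. An X in sp4 is skew for omega, so the form
   omega u (v X^k) is symmetric for odd k and alternating for even k. For nilpotent X <> 0:
   - if X^3 <> 0, a vector v with omega v (v X^3) <> 0, once normalised,
     generates a basis v, vX, vX^2, vX^3 on which X acts as X_alpha + X_beta;
   - X^3 = 0 <> X^2 is impossible: the alternating form omega u (v X^2) has rank
     at least 2, so Frobenius' rank inequality would make X invertible;
   - if X^2 = 0, the symmetric form omega u (v X) has rank 1 or at least 2.
     In rank 1 a unit vector gives X_alpha; otherwise two orthogonal unit vectors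
     v, w give the isotropic vectors v + iw and v - iw, whence X_beta.
   The three normal forms have ranks 2, 1 and 3. *)
Require Import Defs.
From mathcomp Require Import all_boot all_order all_algebra.
From mathcomp Require Import ring.

Set Implicit Arguments.
Unset Strict Implicit.
Unset Printing Implicit Defensive.

Import GRing.Theory Num.Theory.
Local Open Scope ring_scope.

(** Clears the multiples by 0 and 1 that [mulE] leaves in expanded products of matrix units. *)
Definition zeroE (V : zmodType) :=
  (@mulr0n V, @mulr1n V, @oppr0 V, @opprK V, @addr0 V, @add0r V,
   @subr0 V, @sub0r V).

(** * The symplectic form on row vectors *)

Section SymplecticForm.
Variable F : fieldType.
Implicit Types (X g : 'M[F]_4) (u v w : 'rV[F]_4).

Lemma trE i j : (E F i j)^T = E F j i.
Proof. exact: trmx_delta. Qed.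

Lemma mulE i j k l : (0 < j <= 4)%N -> (0 < k <= 4)%N ->
  E F i j *m E F k l = E F i l *+ (j == k).
Proof.
case: j k => [|j] [|k] //= hj hk.
by rewrite mul_delta_mx_cond -val_eqE /= !inordK // eqSS.
Qed.

Lemma trJ : (J F)^T = - J F.
Proof.
apply/matrixP=> i j; rewrite /J !mxE -!val_eqE /= !inordK //.
by case: i => [[|[|[|[|i]]]]] //= _; case: j => [[|[|[|[|j]]]]] //= _; ring.
Qed.

Lemma mulJJ : J F *m J F = - 1%:M.
Proof.
rewrite /J !(mulmxDl, mulmxDr, mulNmx, mulmxN) !mulE //= !zeroE.
apply/matrixP=> i j; rewrite !mxE -!val_eqE /= !inordK //.
by case: i => [[|[|[|[|i]]]]] //= _; case: j => [[|[|[|[|j]]]]] //= _; ring.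
Qed.

Definition omega u v : F := (u *m J F *m v^T) 0 0.

Lemma omegaDl u v w : omega (u + v) w = omega u w + omega v w.
Proof. by rewrite /omega !mulmxDl [LHS]mxE. Qed.

Lemma omegaDr u v w : omega u (v + w) = omega u v + omega u w.
Proof. by rewrite /omega [(v + w)^T]linearD mulmxDr [LHS]mxE. Qed.

Lemma omegaZl c u v : omega (c *: u) v = c * omega u v.
Proof. by rewrite /omega -!scalemxAl [LHS]mxE. Qed.

Lemma omegaZr c u v : omega u (c *: v) = c * omega u v.
Proof. by rewrite /omega [(c *: v)^T]linearZ -scalemxAr [LHS]mxE. Qed.

Lemma omegaNl u v : omega (- u) v = - omega u v.
Proof. by rewrite -scaleN1r omegaZl mulN1r. Qed.

Lemma omegaNr u v : omega u (- v) = - omega u v.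
Proof. by rewrite -scaleN1r omegaZr mulN1r. Qed.

Lemma omega0l v : omega 0 v = 0.
Proof. by rewrite -[0 in LHS](scale0r v) omegaZl mul0r. Qed.

Lemma omega0r u : omega u 0 = 0.
Proof. by rewrite -[0 in LHS](scale0r u) omegaZr mul0r. Qed.

Definition omegaE :=
  (omegaDl, omegaDr, omegaNl, omegaNr, omegaZl, omegaZr, omega0l, omega0r).

Lemma omegaC u v : omega u v = - omega v u.
Proof.
have -> : omega u v = (u *m J F *m v^T)^T 0 0 by rewrite mxE.
by rewrite !trmx_mul trmxK trJ mulNmx mulmxN mulmxA mxE.
Qed.

(** As [J] is invertible, [u *m J] has a nonzero entry; a rescaled coordinate vector picks it
    out. *)
Lemma omega_nondegenerate u : u != 0 -> exists v, omega u v = 1.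
Proof.
move=> u0; have : u *m J F != 0.
  apply: contraNneq u0 => uJ.
  have := congr1 (mulmx^~ (J F)) uJ.
  by rewrite -mulmxA mulJJ mulmxN mulmx1 mul0mx => /eqP; rewrite oppr_eq0.
case/rV0Pn=> j uj; exists (((u *m J F) 0 j)^-1 *: delta_mx 0 j).
by rewrite omegaZr /omega trmx_delta -colE [col j _ 0 0]mxE mulVf.
Qed.

(** Multiplying the equation of [sp4] by [J] on the right turns it into [X J = - J X^T]. *)
Lemma omega_skew X u v : X \in @sp4 F -> omega (u *m X) v = - omega u (v *m X).
Proof.
rewrite inE => /eqP defX; rewrite /omega trmx_mul.
have -> : u *m X *m J F = - (u *m J F *m X^T).
  by rewrite -mulmxA -{1}defX -mulmxA mulJJ !mulmxN mulmx1 mulmxA.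
by rewrite mulNmx mxE -!mulmxA.
Qed.

End SymplecticForm.

(** * Conjugacy of lines: a sufficient criterion and the rank invariant *)

Section Conjugation.
Variable F : fieldType.
Implicit Types (X A B g : 'M[F]_4) (u v w : 'rV[F]_4).

Lemma symplectic_basis_conjugate A B (r : 'I_4 -> 'rV[F]_4) :
    (forall i j, omega (r i) (r j) = J F i j) ->
    (forall i, r i *m A = \sum_j B i j *: r j) ->
  Sp4_conjugate <[A]>%VS <[B]>%VS.
Proof.
move=> symp_r act_r; pose g := \matrix_i r i.
have gJ : g *m J F *m g^T = J F.
  apply/matrixP=> i j; rewrite -symp_r -[r i](rowK r) -[r j](rowK r) /omega.
  rewrite -row_mul [LHS]mxE [RHS]mxE.
  by apply: eq_bigr => k _; congr (_ * _); rewrite !mxE.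
have gU : g \in unitmx.
  (* Since [J] squares to -1, the symplectic relation itself exhibits the inverse of [g]. *)
  have : g *m (- (J F *m g^T *m J F)) = 1%:M.
    by rewrite mulmxN !mulmxA gJ mulJJ opprK.
  by case/mulmx1_unit.
have gA : g *m A = B *m g.
  apply/row_matrixP=> i; rewrite !row_mul rowK act_r mulmx_sum_row.
  by apply: eq_bigr => j _; rewrite mxE rowK.
have gAg : g *m A *m invmx g = B by rewrite gA mulmxK.
exists g; first by rewrite inE gU gJ /=.
move=> Y; split=> [/vlineP[c ->]|[_ /vlineP[c ->] ->]].
  exists (c *: A); first exact/vlineP/ex_intro.
  by rewrite -scalemxAr -scalemxAl gAg.
by rewrite -scalemxAr -scalemxAl gAg; apply/vlineP; exists c.
Qed.

(** [B] is a conjugate of some [c *: A], where [c] is nonzero because [B] is; neither operation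
    changes the rank. *)
Lemma Sp4_conjugate_line_rank A B :
  A != 0 -> B != 0 -> Sp4_conjugate <[A]>%VS <[B]>%VS -> \rank A = \rank B.
Proof.
move=> A0 B0 [g]; rewrite inE => /andP[gU _] /(_ B)[/(_ (memv_line B))].
case=> _ /vlineP[c ->] defB _.
have c0 : c != 0.
  by apply: contraNneq B0 => c0; rewrite defB c0 scale0r mulmx0 mul0mx.
rewrite defB mxrankMfree ?row_free_unit ?unitmx_inv //.
rewrite -[in RHS]mxrank_tr trmx_mul mxrankMfree.
  by rewrite mxrank_tr mxrank_scale_nz.
by rewrite row_free_unit unitmx_tr.
Qed.

End Conjugation.

Lemma leq_mxrank_sandwich (F : fieldType) m n k (A : 'M[F]_(m, n))
    (P : 'M[F]_(k, m)) (Q : 'M[F]_(n, k)) :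
  P *m A *m Q = 1%:M -> (k <= \rank A)%N.
Proof.
move=> PAQ; rewrite -(mxrank1 F k) -PAQ.
exact: leq_trans (mxrankM_maxl _ _) (mxrankM_maxr _ _).
Qed.

(** * The three normal forms: ranks, membership, nilpotency *)

Section NormalForms.
Variable F : fieldType.

Local Notation Xa := (X_alpha F).
Local Notation Xb := (X_beta F).

Lemma mxrank_X_alpha : \rank Xa = 1%N.
Proof. exact: mxrank_delta. Qed.

Lemma mxrank_X_beta : \rank Xb = 2%N.
Proof.
apply/eqP; rewrite eqn_leq; apply/andP; split.
  apply: leq_trans (mxrank_add _ _) _.
  by rewrite -scaleN1r mxrank_scale_nz ?oppr_eq0 ?oner_eq0 // !mxrank_delta.
(* [P] selects the first and last rows of [X_beta], which are up to sign distinct coordinate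
   vectors, so the transpose of the selection is a right inverse. *)
pose P : 'M[F]_(2, 4) := \matrix_(i, j) (j == 3 * i :> nat)%N%:R.
apply: (@leq_mxrank_sandwich _ _ _ _ _ P (P *m Xb)^T).
apply/matrixP=> i j; rewrite !mxE !big_ord_recl big_ord0 !mxE.
rewrite !big_ord_recl !big_ord0 !mxE -!val_eqE /= !inordK //.
by case: i => [[|[|i]]] //= _; case: j => [[|[|j]]] //= _; ring.
Qed.

Lemma mxrank_X_alphaD_X_beta : (3 <= \rank (Xa + Xb)%R)%N.
Proof.
(* The same device with rows 0, 1 and 3, counted from 0: the shift at [i = 2] skips the zero row. *)
pose P : 'M[F]_(3, 4) := \matrix_(i, j) (j == i + (i == 2%N :> nat) :> nat)%N%:R.
apply: (@leq_mxrank_sandwich _ _ _ _ _ P (P *m (Xa + Xb))^T).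
apply/matrixP=> i j; rewrite !mxE !big_ord_recl big_ord0 !mxE.
rewrite !big_ord_recl !big_ord0 !mxE -!val_eqE /= !inordK //.
by case: i => [[|[|[|i]]]] //= _; case: j => [[|[|[|j]]]] //= _; ring.
Qed.

Lemma X_alpha_sp4 : Xa \in @sp4 F.
Proof.
rewrite inE /J /Xa trE; apply/eqP.
by rewrite !(mulmxDl, mulmxDr, mulNmx, mulmxN) !mulE //= !zeroE !mul0mx !zeroE.
Qed.

Lemma X_beta_sp4 : Xb \in @sp4 F.
Proof.
rewrite inE /Xb [(_ - _)^T]raddfB /= !trE; apply/eqP.
have -> : J F *m (E F 2 1 - E F 3 4) = - E F 1 4 - E F 4 1.
  by rewrite /J !(mulmxDl, mulmxDr, mulNmx, mulmxN) !mulE //= !zeroE.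
by rewrite /J !(mulmxDl, mulmxDr, mulNmx, mulmxN) !mulE //= !zeroE.
Qed.

Lemma sp4D (X Y : 'M[F]_4) : X \in @sp4 F -> Y \in @sp4 F -> X + Y \in @sp4 F.
Proof.
rewrite !inE => /eqP eX /eqP eY.
by rewrite [(X + Y)^T]raddfD /= (mulmxDr (J F)) (mulmxDl _ _ (J F)) eX eY.
Qed.

Lemma sp4Z c (X : 'M[F]_4) : X \in @sp4 F -> c *: X \in @sp4 F.
Proof. by rewrite !inE [(c *: X)^T]linearZ /= -scalemxAr -scalemxAl => /eqP->. Qed.

Lemma one_dim_nilpotent_line (X : 'M[F]_4) :
    X \in @sp4 F -> X != 0 -> nilpotent_mx X ->
  one_dim_nilpotent_subalgebra <[X]>%VS.
Proof.
move=> spX X0 nX; split; last by exists X; rewrite memv_line.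
  split=> [_ /vlineP[c ->]|_ _ /vlineP[c ->] /vlineP[d ->]]; first exact: sp4Z.
  rewrite /bracket -!scalemxAl -!scalemxAr !scalerA mulrC subrr.
  exact: mem0v.
by rewrite dim_vline X0.
Qed.

Lemma nilpotent_X_alpha : nilpotent_mx Xa.
Proof. by exists 2%N; rewrite expr2 -mulmxE mulE. Qed.

Lemma nilpotent_X_beta : nilpotent_mx Xb.
Proof.
exists 2%N; rewrite expr2 -mulmxE /Xb.
by rewrite !(mulmxDl, mulmxDr, mulNmx, mulmxN) !mulE //= !zeroE.
Qed.

Lemma nilpotent_X_alphaD_X_beta : nilpotent_mx (Xa + Xb).
Proof.
exists 4%N; rewrite (exprM _ 2 2) !expr2 -!mulmxE.
have -> : (Xa + Xb) *m (Xa + Xb) = - E F 2 3 + E F 1 4.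
  by rewrite /Xa /Xb !(mulmxDl, mulmxDr, mulNmx, mulmxN) !mulE //= !zeroE.
by rewrite !(mulmxDl, mulmxDr, mulNmx, mulmxN) !mulE //= !zeroE.
Qed.

End NormalForms.

Lemma row_neq0 (V : nmodType) m n (A : 'M[V]_(m, n)) :
  A != 0 -> exists i, row i A != 0.
Proof.
move=> A0; apply/existsP; apply: contraNT A0 => /existsPn A0.
by apply/eqP/row_matrixP=> i; rewrite row0; apply/eqP/negPn/A0.
Qed.

(** * Reduction to normal form over an algebraically closed field of characteristic zero *)

Section Conjugacy.
Variable C : numClosedFieldType.
Implicit Types (A X : 'M[C]_4) (u v w : 'rV[C]_4).

(** Antisymmetry suffices because 2 is nonzero here. *)
Lemma omega_alt u : omega u u = 0.
Proof. by apply/eqP; rewrite -eqNr -omegaC. Qed.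

(** Only pairings above the diagonal are listed; [omegaC] and [omega_alt] give the others. *)
Definition symplectic_basis v1 v2 v3 v4 : Prop :=
  [/\ [/\ omega v1 v2 = 0, omega v1 v3 = 1 & omega v1 v4 = 0],
      omega v2 v3 = 0, omega v2 v4 = 1 & omega v3 v4 = 0].

Lemma symplectic_tuple v1 v2 v3 v4 :
  symplectic_basis v1 v2 v3 v4 ->
  forall i j : 'I_4, omega (nth 0 [:: v1; v2; v3; v4] i)
                           (nth 0 [:: v1; v2; v3; v4] j) = J C i j.
Proof.
case=> -[h12 h13 h14] h23 h24 h34 i j.
rewrite /J !mxE -!val_eqE /= !inordK //.
case: i => [[|[|[|[|i]]]]] //= _; case: j => [[|[|[|[|j]]]]] //= _;
  by rewrite ?omega_alt ?(h12, h13, h14, h23, h24, h34) 1?omegaC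
     ?(h12, h13, h14, h23, h24, h34); ring.
Qed.

Lemma conjugate_X_alpha A v1 v2 v3 v4 :
    symplectic_basis v1 v2 v3 v4 ->
    v1 *m A = 0 -> v2 *m A = v4 -> v3 *m A = 0 -> v4 *m A = 0 ->
  Sp4_conjugate <[A]>%VS <[X_alpha C]>%VS.
Proof.
move=> sv A1 A2 A3 A4.
apply: symplectic_basis_conjugate (symplectic_tuple sv) _.
move=> i; rewrite !big_ord_recl big_ord0 !mxE -!val_eqE /= !inordK //.
by case: i => [[|[|[|[|i]]]]] //= _; rewrite ?(A1, A2, A3, A4);
   rewrite ?(scale0r, scale1r, add0r, addr0).
Qed.

Lemma conjugate_X_beta A v1 v2 v3 v4 :
    symplectic_basis v1 v2 v3 v4 ->
    v1 *m A = v2 -> v2 *m A = 0 -> v3 *m A = 0 -> v4 *m A = - v3 ->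
  Sp4_conjugate <[A]>%VS <[X_beta C]>%VS.
Proof.
move=> sv A1 A2 A3 A4.
apply: symplectic_basis_conjugate (symplectic_tuple sv) _.
move=> i; rewrite !big_ord_recl big_ord0 !mxE -!val_eqE /= !inordK //.
by case: i => [[|[|[|[|i]]]]] //= _; rewrite ?(A1, A2, A3, A4);
   rewrite ?subr0 ?sub0r ?(scale0r, scale1r, scaleN1r, oppr0, add0r, addr0).
Qed.

Lemma conjugate_X_alphaD_X_beta A v1 v2 v3 v4 :
    symplectic_basis v1 v2 v3 v4 ->
    v1 *m A = v2 -> v2 *m A = v4 -> v3 *m A = 0 -> v4 *m A = - v3 ->
  Sp4_conjugate <[A]>%VS <[X_alpha C + X_beta C]>%VS.
Proof.
move=> sv A1 A2 A3 A4.
apply: symplectic_basis_conjugate (symplectic_tuple sv) _.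
move=> i; rewrite !big_ord_recl big_ord0 !mxE -!val_eqE /= !inordK //.
by case: i => [[|[|[|[|i]]]]] //= _; rewrite ?(A1, A2, A3, A4);
   rewrite ?subr0 ?sub0r ?(scale0r, scale1r, scaleN1r, oppr0, add0r, addr0).
Qed.

(** This form of the [sp4] condition is also convenient for the cube of [X] and for a rank-one
    correction of [X]. *)
Definition skew A := forall u v, omega (u *m A) v = - omega u (v *m A).

Lemma skew_formC A u v : skew A -> omega u (v *m A) = omega v (u *m A).
Proof. by move=> sA; rewrite omegaC sA opprK. Qed.

(** A nonzero symmetric form in characteristic zero has a non-isotropic vector, by polarization; a
    square root normalises it. *)
Lemma skew_unit_vector A : skew A -> A != 0 -> exists v, omega v (v *m A) = 1.
Proof.
move=> sA A0.
suff [v qv] : exists v, omega v (v *m A) != 0.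
  exists ((sqrtC (omega v (v *m A)))^-1 *: v).
  rewrite -scalemxAl omegaZl omegaZr mulrA -invfM -expr2 sqrtCK mulVf //.
have [i Ai] := row_neq0 A0.
have [w] := omega_nondegenerate Ai; rewrite rowE omegaC.
set u := delta_mx 0 i => uw.
have [qu|] := eqVneq (omega u (u *m A)) 0; last by exists u.
have [qw|] := eqVneq (omega w (w *m A)) 0; last by exists w.
(* With [u] and [w] both isotropic, only the doubled cross term survives, and it is -2. *)
exists (u + w); rewrite mulmxDl !omegaE qu qw (skew_formC _ _ sA) add0r addr0.
by rewrite -mulr2n -[X in X *+ 2]opprK uw mulrn_eq0 oppr_eq0 oner_eq0.
Qed.


Lemma regular_nilpotent_conjugate X :
    skew X -> X *m X *m X *m X = 0 -> X *m X *m X != 0 ->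
  Sp4_conjugate <[X]>%VS <[X_alpha C + X_beta C]>%VS.
Proof.
move=> sX X4 X3.
have [|v] := skew_unit_vector _ X3.
  by move=> u v; rewrite !mulmxA !sX opprK.
rewrite !mulmxA => qv.
have [p0 w03] : exists p0, omega p0 (p0 *m X *m X *m X) = -1.
  (* Scaling by ['i] flips the sign, so that [omega p1 p2] becomes 1. *)
  by exists ('i *: v); rewrite -!scalemxAl !omegaE qv mulr1 -expr2 sqrCi.
pose p1 := p0 *m X; pose p2 := p1 *m X; pose p3 := p2 *m X.
have p4 : p3 *m X = 0 by rewrite -(mulmx0 _ p0) -X4 !mulmxA.
rewrite -[p0 *m X]/p1 -[p1 *m X]/p2 -[p2 *m X]/p3 in w03.
have w12 : omega p1 p2 = 1 by rewrite sX w03 opprK.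
have w02 : omega p0 p2 = 0 by rewrite -[LHS]opprK -sX omega_alt oppr0.
have w13 : omega p1 p3 = 0 by rewrite sX p4 omega0r oppr0.
have w23 : omega p2 p3 = 0 by rewrite sX p4 omega0r oppr0.
(* The only unwanted pairing is [omega p0 p1]; the shifts by [t *: p2] and [t *: p3] lower it by
   [2 t] and respect the action of [X]. *)
pose t := omega p0 p1 / 2.
apply: (@conjugate_X_alphaD_X_beta _ (p0 + t *: p2) (p1 + t *: p3) (- p3) p2).
- have [w20 w21] : omega p2 p0 = 0 /\ omega p2 p1 = -1.
    by rewrite omegaC w02 oppr0 omegaC w12.
  split; first split;
    rewrite ?(omegaE, w03, w12, w02, w13, w23, w20, w21, omega_alt) //;
    rewrite ?(omegaC p3) ?(w03, w12, w02, w13, w23); try ring.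
  by rewrite /t; field.
- by rewrite mulmxDl -scalemxAl.
- by rewrite mulmxDl -scalemxAl p4 scaler0 addr0.
- by rewrite mulNmx p4 oppr0.
by rewrite opprK.
Qed.

Lemma mxrank_alternating A :
  (forall u, omega u (u *m A) = 0) -> A != 0 -> (2 <= \rank A)%N.
Proof.
move=> altA A0.
have symA u v : omega (u *m A) v = omega u (v *m A).
  have := altA (u + v); rewrite mulmxDl !omegaE !altA add0r addr0.
  by move/eqP; rewrite addr_eq0 => /eqP->; rewrite omegaC.
have [i Ai] := row_neq0 A0.
have [u] := omega_nondegenerate Ai; rewrite rowE.
set v := delta_mx 0 i => vu.
(* Testing [v, u] against [u, - v] turns the 2 by 2 alternating Gram matrix into the identity. *)
apply: (@leq_mxrank_sandwich _ _ _ _ _ (col_mx v u)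
  (row_mx (J C *m u^T) (J C *m (- v)^T))).
rewrite mul_col_mx mul_col_row !mulmxA.
have omegaM (a b : 'rV[C]_4) : a *m J C *m b^T = (omega a b)%:M.
  by rewrite [LHS]mx11_scalar.
rewrite !omegaM !omegaNr (symA v v) (symA u u) !altA vu (symA u v) omegaC.
by rewrite vu oppr0 opprK raddf0 -scalar_mx_block.
Qed.

Lemma skew_nilpotent_index_neq3 X :
  skew X -> X *m X *m X = 0 -> X *m X = 0.
Proof.
move=> sX X3; apply/eqP; apply: contraT => X2.
have rX2 : (2 <= \rank (X *m X))%N.
  apply: mxrank_alternating X2 => u.
  by rewrite mulmxA -[LHS]opprK -sX omega_alt oppr0.
have := mxrank_Frobenius X X X; rewrite X3 mxrank0 addn0.
move/(leq_trans (leq_add rX2 rX2)) => rX.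
have fX : row_free X by rewrite /row_free eqn_leq rX rank_leq_row.
by move: X2; rewrite -mxrank_eq0 -(mxrankMfree _ fX) X3 mxrank0.
Qed.

Lemma symplectic_complement v w : omega v w = 1 ->
  exists u u', [/\ omega u u' = 1, omega u v = 0, omega u w = 0,
                  omega u' v = 0 & omega u' w = 0].
Proof.
move=> vw.
pose A := row_mx (J C *m v^T) (J C *m w^T).
have : kermx A != 0.
  (* Two linear conditions on a space of dimension 4 leave a nonzero solution. *)
  rewrite -mxrank_eq0 mxrank_ker subn_eq0 -ltnNge.
  exact: leq_ltn_trans (rank_leq_col A) _.
case/rowV0Pn=> u /sub_kermxP uA u0.
have [uv uw] : omega u v = 0 /\ omega u w = 0.
  move: uA; rewrite mul_mx_row !mulmxA -row_mx0 => /eq_row_mx[uv uw].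
  by rewrite /omega uv uw !mxE.
have [u1 uu1] := omega_nondegenerate u0.
(* The correction removes the component of [u1] in the plane of [v, w]; its pairing with [u] is
   unchanged, as [u] is orthogonal to that plane. *)
exists u, (u1 - omega u1 w *: v + omega u1 v *: w).
split; rewrite ?omegaE ?(uu1, uv, uw, vw, omega_alt, omegaC w v); ring.
Qed.

Lemma square_zero_nilpotent_conjugate X :
    skew X -> X *m X = 0 -> X != 0 ->
  Sp4_conjugate <[X]>%VS <[X_alpha C]>%VS \/
  Sp4_conjugate <[X]>%VS <[X_beta C]>%VS.
Proof.
move=> sX X2 X0.
have [v qv] := skew_unit_vector sX X0.
(* Completing the square: the symmetric form of [X'] is that of [X] minus the square of the
   functional [omega _ (v *m X)]. It vanishes exactly when the form of [X] has rank one. *)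
pose X' := X - (J C *m (v *m X)^T) *m (v *m X).
have actX' u : u *m X' = u *m X - omega u (v *m X) *: (v *m X).
  rewrite mulmxBr !(mulmxA u); congr (_ - _).
  by rewrite [u *m J C *m _]mx11_scalar mul_scalar_mx.
have wXX a b : omega (a *m X) (b *m X) = 0.
  by rewrite sX -mulmxA X2 mulmx0 omega0r oppr0.
have [X'0|X'0] := eqVneq X' 0.
  left; have [u [u' [uu' uv uw u'v u'w]]] := symplectic_complement qv.
  have actX z : z *m X = omega z (v *m X) *: (v *m X).
    by apply/eqP; rewrite -subr_eq0 -actX' X'0 mulmx0.
  apply: (@conjugate_X_alpha _ u v u' (v *m X)).
  - by split; first split; rewrite // omegaC u'v oppr0.
  - by rewrite actX uw scale0r.
  - by [].
  - by rewrite actX u'w scale0r.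
  - by rewrite -mulmxA X2 mulmx0.
right.
have sX' : skew X'.
  move=> a b; rewrite !actX' !omegaE sX (omegaC (v *m X)); ring.
have [w0 qw0] := skew_unit_vector sX' X'0.
(* Gram-Schmidt against [v]; the form of [X] at [w] equals the form of [X'] at [w0], namely 1. *)
pose w := w0 - omega w0 (v *m X) *: v.
have qwv : omega w (v *m X) = 0 by rewrite /w !omegaE qv; ring.
have qvw : omega v (w *m X) = 0 by rewrite skew_formC.
have qw : omega w (w *m X) = 1.
  apply: etrans qw0; rewrite actX' /w mulmxBl -scalemxAl !omegaE.
  by rewrite qv (skew_formC v w0 sX); ring.
(* Both vectors are isotropic for the form of [X]; the factor [- 2^-1] brings their mutual pairing
   from 2 to -1. *)
clearbody w; pose a := v + 'i *: w; pose b := (- 2^-1) *: (v - 'i *: w).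
have qaa : omega a (a *m X) = 0.
  rewrite /a mulmxDl -scalemxAl !omegaE qv qw qvw qwv.
  by rewrite mulr0 add0r addr0 mulr1 -expr2 sqrCi subrr.
have qbb : omega b (b *m X) = 0.
  rewrite /b -scalemxAl mulmxBl -scalemxAl !omegaE qv qw qvw qwv.
  transitivity (2^-1 ^+ 2 * (1 + 'i ^+ 2) : C); first by ring.
  by rewrite sqrCi subrr mulr0.
have qab : omega a (b *m X) = -1.
  rewrite /a /b -scalemxAl mulmxBl -scalemxAl !omegaE qv qw qvw qwv.
  transitivity (- 2^-1 * (1 - 'i ^+ 2) : C); first by ring.
  by rewrite sqrCi; field.
have qba : omega b (a *m X) = -1 by rewrite skew_formC.
(* As [a *m X] pairs to 1 with [b], adding [s *: (a *m X)] to [a] makes it orthogonal to [b], and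
   [X] does not see the change. *)
clearbody a b; pose s := - omega a b.
have XX0 z : z *m X *m X = 0 by rewrite -mulmxA X2 mulmx0.
apply: (@conjugate_X_beta _ (a + s *: (a *m X)) (a *m X) (- (b *m X)) b).
- split; first split;
    rewrite ?omegaE ?wXX ?sX ?(qaa, qbb, qab, qba); try ring.
  by rewrite /s; ring.
- by rewrite mulmxDl -scalemxAl XX0 scaler0 addr0.
- exact: XX0.
- by rewrite mulNmx XX0 oppr0.
by rewrite opprK.
Qed.

(** The minimal polynomial divides a power of ['X], hence is associate to one, and its degree is at
    most 4 because it divides the characteristic polynomial. *)
Lemma nilpotent_mx_exp4 (F : fieldType) (A : 'M[F]_4) :
  nilpotent_mx A -> A ^+ 4 = 0.
Proof.
case=> k Ak.
have : mxminpoly A %| ('X - 0%:P) ^+ k.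
  by apply: mxminpoly_min; rewrite subr0 rmorphXn /= horner_mx_X.
case/dvdp_exp_XsubCP=> m _ eqp_m.
have m4 : (m <= 4)%N.
  have := dvdp_leq (monic_neq0 (char_poly_monic A)) (mxminpoly_dvd_char A).
  by rewrite (eqp_size eqp_m) size_exp_XsubC size_char_poly.
have : mxminpoly A %| 'X ^+ 4.
  by rewrite (eqp_dvdl _ eqp_m) subr0 dvdp_exp2l.
by rewrite dvd_mxminpoly rmorphXn /= horner_mx_X => /eqP.
Qed.

End Conjugacy.

Theorem theorem4p2 (R : realType) :
  complete_list (@one_dim_nilpotent_subalgebra (complex R))
    (@Sp4_conjugate (complex R))
    [:: <[X_beta (complex R)]>%VS;
        <[X_alpha (complex R)]>%VS;
        <[(X_alpha (complex R) + X_beta (complex R))%R]>%VS].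
Proof.
set C := complex R; pose gens := [:: X_beta C; X_alpha C; X_alpha C + X_beta C].
(* The ranks are 2, 1 and at least 3, in list order, so rank determines the index. *)
have ranks i j : (i < 3)%N -> (j < 3)%N ->
    \rank (gens`_i) = \rank (gens`_j) -> i = j.
  case: i => [|[|[|i]]] // _; case: j => [|[|[|j]]] // _ /=;
  rewrite ?mxrank_X_alpha ?mxrank_X_beta // => eq_rank;
  by have := mxrank_X_alphaD_X_beta C;
     first [by [] | rewrite eq_rank | rewrite -eq_rank].
have gens0 i : (i < 3)%N -> gens`_i != 0.
  case: i => [|[|[|i]]] // _ /=; rewrite -mxrank_eq0;
    rewrite ?mxrank_X_alpha ?mxrank_X_beta //.
  by rewrite -lt0n (leq_trans _ (mxrank_X_alphaD_X_beta C)).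
split.
- move=> U; rewrite !inE => /or3P[]/eqP->; apply: one_dim_nilpotent_line.
  + exact: X_beta_sp4.
  + exact: (gens0 0%N).
  + exact: nilpotent_X_beta.
  + exact: X_alpha_sp4.
  + exact: (gens0 1%N).
  + exact: nilpotent_X_alpha.
  + exact: sp4D (X_alpha_sp4 _) (X_beta_sp4 _).
  + exact: (gens0 2%N).
  + exact: nilpotent_X_alphaD_X_beta.
- move=> U0 i j /= i3 j3 ij.
  have nthE k : (k < 3)%N ->
      nth U0 [:: <[X_beta C]>; <[X_alpha C]>; <[(X_alpha C + X_beta C)%R]>]%VS k
        = <[gens`_k]>%VS.
    by case: k => [|[|[|k]]].
  rewrite !nthE // => /Sp4_conjugate_line_rank; move/(_ (gens0 i i3) (gens0 j j3)).
  by move/ranks => /(_ i3 j3).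
move=> U [[spU _] dimU [X [XU X0 nX]]].
(* A line is spanned by any nonzero element, so the nilpotent one may serve as generator. *)
have -> : U = <[X]>%VS.
  by apply/esym/eqP; rewrite eqEdim -memvE XU dimU dim_vline X0.
have sX : skew X by move=> u v; apply: omega_skew; apply: spU.
have X4 : X *m X *m X *m X = 0.
  by have := nilpotent_mx_exp4 nX; rewrite !exprSr expr0 mul1r.
have [X3|X3] := eqVneq (X *m X *m X) 0; last first.
  exists <[(X_alpha C + X_beta C)%R]>%VS; first by rewrite !inE eqxx !orbT.
  exact: regular_nilpotent_conjugate.
have [] := square_zero_nilpotent_conjugate sX (skew_nilpotent_index_neq3 sX X3) X0.
  by exists <[X_alpha C]>%VS; rewrite // !inE eqxx orbT.
by exists <[X_beta C]>%VS; rewrite // !inE eqxx.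
Qed.
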